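(* Let $n\ge 3$. Every solvable Leibniz algebra belonging to the set $L(n,n-1)$ is a Lie algebra. That is, every non-nilpotent solvable Leibniz algebra over $\mathbb{C}$ whose nilradical is $T(n)$ and in which the complementary vector space of the nilradical has dimension $n-1$ is a Lie algebra.
   Context: All vector spaces and algebras are finite-dimensional over $\mathbb{C}$. A (right) Leibniz algebra is an algebra $(L,[-,-])$ satisfying $[x,[y,z]]=[[x,y],z]-[[x,z],y]$ for all $x,y,z\in L$. The lower central series is $L^1=L$, $L^{k+1}=[L^k,L]$ and the derived series is $L^{[1]}=L$, $L^{[s+1]}=[L^{[s]},L^{[s]}]$; $L$ is nilpotent (resp. solvable) if $L^{k}=0$ (resp. $L^{[m]}=0$) for some $k$ (resp. $m$). The nilradical of $L$ is its maximal nilpotent (two-sided) ideal. For $n\ge 3$, $T(n)$ denotes the Lie algebra of strictly upper triangular $n\times n$ complex matrices, with basis $\{N_{ij} : 1\le i<j\le n\}$ (where $N_{ij}$ is the matrix with single nonzero entry $1$ at position $(i,j)$) and products $[N_{ij},N_{kl}]=\delta_{jk}N_{il}-\delta_{il}N_{kj}$. $L(n,f)$ denotes the set of all non-nilpotent solvable Leibniz algebras with nilradical $T(n)$ and a complementary vector space $\langle X^1,\dots,X^f\rangle$ (of dimension $f$) to the nilradical. *)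

(* Defs.v *)
From HB Require Import structures.
From mathcomp Require Import all_boot all_order all_algebra.
From mathcomp Require Import reals complex.

Set Implicit Arguments.
Unset Strict Implicit.
Unset Printing Implicit Defensive.

Import GRing.Theory.
Local Open Scope ring_scope.

(* An algebra is a vectType L with a bilinear bracket br : L -> L -> L. *)

Definition is_leibniz (K : fieldType) (L : vectType K)
    (br : {bilinear L -> L -> L}) : Prop :=
  forall x y z : L, br x (br y z) = br (br x y) z - br (br x z) y.

Definition is_lie (K : fieldType) (L : vectType K)
    (br : {bilinear L -> L -> L}) : Prop :=
  (forall x : L, br x x = 0) /\
  (forall x y z : L, br x (br y z) + br y (br z x) + br z (br x y) = 0).

(* [U, V]: the linear span of all brackets, computed on bases as for prodv in
   falgebra (see bracketvP below). *)
Definition bracketv (K : fieldType) (L : vectType K)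
    (br : {bilinear L -> L -> L}) (U V : {vspace L}) : {vspace L} :=
  <<[seq br u v | u <- vbasis U, v <- vbasis V]>>%VS.

Lemma memv_bracketv (K : fieldType) (L : vectType K)
    (br : {bilinear L -> L -> L}) (U V : {vspace L}) :
  {in U & V, forall u v, br u v \in bracketv br U V}.
Proof.
move=> u v /coord_vbasis-> /coord_vbasis->.
rewrite linear_sumlz; apply: memv_suml => i _.
rewrite linear_sumr; apply: memv_suml => j _.
rewrite linearZl_LR linearZr_LR !memvZ // memv_span //.
by apply/allpairsP; exists ((vbasis U)`_i, (vbasis V)`_j); rewrite !memt_nth.
Qed.

Lemma bracketvP (K : fieldType) (L : vectType K)
    (br : {bilinear L -> L -> L}) (U V W : {vspace L}) :
  reflect {in U & V, forall u v, br u v \in W} (bracketv br U V <= W)%VS.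
Proof.
apply: (iffP idP) => [sUVW u v Uu Vv | sUVW].
  by rewrite (subvP sUVW) ?memv_bracketv.
apply/span_subvP=> _ /allpairsP[[u v] /= [Uu Vv ->]].
by rewrite sUVW ?vbasis_mem.
Qed.

(* Indices start at 0: lcs br U k is U^{k+1} and dser br U s is U^{[s+1]}. *)
Fixpoint lcs (K : fieldType) (L : vectType K) (br : {bilinear L -> L -> L})
    (U : {vspace L}) (k : nat) : {vspace L} :=
  if k is k'.+1 then bracketv br (lcs br U k') U else U.

Fixpoint dser (K : fieldType) (L : vectType K) (br : {bilinear L -> L -> L})
    (U : {vspace L}) (s : nat) : {vspace L} :=
  if s is s'.+1 then bracketv br (dser br U s') (dser br U s') else U.

Definition nilpotentv (K : fieldType) (L : vectType K)
    (br : {bilinear L -> L -> L}) (U : {vspace L}) : Prop :=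
  exists k : nat, lcs br U k = 0%VS.

Definition solvablev (K : fieldType) (L : vectType K)
    (br : {bilinear L -> L -> L}) (U : {vspace L}) : Prop :=
  exists s : nat, dser br U s = 0%VS.

Definition is_ideal (K : fieldType) (L : vectType K)
    (br : {bilinear L -> L -> L}) (I : {vspace L}) : Prop :=
  forall x y : L, x \in I -> br x y \in I /\ br y x \in I.

(* In a Leibniz algebra the sum of two nilpotent ideals is a nilpotent ideal,
   so an inclusion-maximal nilpotent ideal is unique. *)
Definition is_nilradical (K : fieldType) (L : vectType K)
    (br : {bilinear L -> L -> L}) (N : {vspace L}) : Prop :=
  [/\ is_ideal br N, nilpotentv br N
    & forall I : {vspace L}, is_ideal br I -> nilpotentv br I ->
        (N <= I)%VS -> I = N].

(* The subspace U of (A, brA) is isomorphic, as an algebra, to the subspace V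
   of (B, brB); a linear map U -> V is represented by an extension to A. *)
Definition isomorphic_on (K : fieldType) (A B : vectType K)
    (brA : A -> A -> A) (brB : B -> B -> B)
    (U : {vspace A}) (V : {vspace B}) : Prop :=
  exists f : 'Hom(A, B),
    [/\ (f @: U)%VS = V, {in U &, injective f}
      & {in U &, {morph f : x y / brA x y >-> brB x y}}].

Definition mx_commutator (K : fieldType) (n : nat) (A B : 'M[K]_n) : 'M[K]_n :=
  A *m B - B *m A.

(* T(n): the span of the matrix units N_ij with i < j. *)
Definition strict_upper (K : fieldType) (n : nat) : {vspace 'M[K]_n} :=
  (\sum_(ij : 'I_n * 'I_n | (ij.1 < ij.2)%N) <[delta_mx ij.1 ij.2]>)%VS.

(* (L, br) belongs to L(n, f). *)
Definition in_Lnf (K : fieldType) (n f : nat) (L : vectType K)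
    (br : {bilinear L -> L -> L}) : Prop :=
  [/\ is_leibniz br, ~ nilpotentv br fullv, solvablev br fullv
    & exists N Q : {vspace L},
        [/\ is_nilradical br N,
            isomorphic_on (@mx_commutator K n) br (strict_upper K n) N,
            (N + Q)%VS = fullv, (N :&: Q)%VS = 0%VS & \dim Q = f]].

(* Main.v *)
From HB Require Import structures.
Require Import Defs.
From mathcomp Require Import all_boot all_order all_algebra.
From mathcomp Require Import reals complex spectral.

Set Implicit Arguments.
Unset Strict Implicit.
Unset Printing Implicit Defensive.

Import GRing.Theory Num.Theory.
Local Open Scope ring_scope.

(* Only three properties of N = T(n) matter: its bracket is anticommutative, its
   centre lies in N^2 = [N, N], and dim (N / N^2) <= n - 1.

   The right annihilator Z = {z | [L, z] = 0} is an ideal containing all squares.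
   N + Z is nilpotent, so Z lies in N, hence in the centre of N, hence in N^2;
   on N^2 the Leibniz identity gives [y, w] = - [w, y], so an element of Z also
   has [e, L] = 0.  It remains to see that such an e in N vanishes.

   By Lie's theorem L acts on N / N^2 triangularly with weights alpha_1, ...,
   alpha_m, m <= n - 1 = dim (L / N).  Either some x has alpha_i x = 1 for all i,
   and then, right multiplication by x being a derivation, its only eigenvalue
   on N^k / N^(k+1) is k, which is incompatible with [e, x] = 0 for e <> 0 in the
   nilpotent algebra N.  Or the alpha_i have a common zero x outside N, and then
   the ideal K of the elements acting nilpotently on N is not contained in N; as
   L is solvable, K contains an ideal M properly containing N with [M, M] <= N,
   and M is nilpotent because it acts on N by a strict flag, contradicting the
   maximality of N. *)

Lemma dser_bracketv (F : fieldType) (L : vectType F) (br : {bilinear L -> L -> L})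
    (U : {vspace L}) s : dser br (bracketv br U U) s = dser br U s.+1.
Proof. by elim: s => //= s ->. Qed.

(** * Lie's theorem for a solvable algebra acting on row vectors from the right *)

Section LieTheorem.
Variables (F : numClosedFieldType) (L : vectType F) (br : {bilinear L -> L -> L}).
Variables (d : nat) (rho : {linear L -> 'M[F]_d}).
Hypothesis rho_br : forall x y, rho (br x y) = rho x *m rho y - rho y *m rho x.

Definition krylov (v : 'rV[F]_d) (Z : 'M_d) m : 'M_(m, d) :=
  \matrix_(i < m) iter i (mulmx^~ Z) v.

(** Induction on [i] through [rho z *m rho h = rho h *m rho z - rho (br h z)]: as [br h z] stays in
    [H], the induction hypothesis covers both terms, and only the first one reaches the leading
    vector. *)
Lemma krylov_weight (v : 'rV[F]_d) (lam : L -> F) (H : {vspace L}) z :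
    {in H, forall h, br h z \in H} ->
    {in H, forall h, v *m rho h = lam h *: v} ->
  forall i h, h \in H -> exists c : nat -> F,
    iter i (mulmx^~ (rho z)) v *m rho h = lam h *: iter i (mulmx^~ (rho z)) v
      + \sum_(j < i) c j *: iter j (mulmx^~ (rho z)) v.
Proof.
move=> Hz vH; elim=> [|i IHi] h hH.
  by exists (fun=> 0); rewrite big_ord0 addr0 /= vH.
have [c cE] := IHi h hH; have [c' c'E] := IHi _ (Hz h hH).
pose w j := iter j (mulmx^~ (rho z)) v.
(* Multiplication by [rho z] shifts the coefficients [c] up by one; the expansion for [br h z] is
   subtracted, its leading coefficient landing at [j = i]. *)
pose e (j : nat) : F :=
  (if j is j'.+1 then c j' else 0)
   - (if j == i then lam (br h z) else c' j).
exists e.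
have -> : iter i.+1 (mulmx^~ (rho z)) v *m rho h
    = w i *m rho h *m rho z - w i *m rho (br h z).
  by rewrite rho_br mulmxBr !mulmxA opprB addrCA subrr addr0.
rewrite {1}/w cE {1}/w c'E mulmxDl -scalemxAl mulmx_suml -addrA.
congr (_ + _).
rewrite /e; under [RHS]eq_bigr do rewrite scalerBl.
rewrite big_split /= sumrN; congr (_ - _).
  rewrite big_ord_recl scale0r add0r; apply: eq_bigr => j _.
  by rewrite -scalemxAl.
rewrite big_ord_recr /= eqxx addrC; congr (_ + _).
by apply: eq_bigr => j _; rewrite ltn_eqF.
Qed.

(** Take the least [m] for which [m.+1] iterates are dependent: the iterate of index [m] lies in the
    span of the earlier ones. *)
Lemma krylov_rank v Z : v != 0 ->
  exists m, [/\ (0 < m)%N, row_free (krylov v Z m)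
    & (krylov v Z m *m Z <= krylov v Z m)%MS].
Proof.
move=> v0.
have Pex : exists m, ~~ row_free (krylov v Z m.+1).
  exists d; rewrite /row_free neq_ltn; apply/orP; left.
  by rewrite ltnS rank_leq_col.
case: (ex_minnP Pex) => m Pm minm; exists m.
have m0 : (0 < m)%N.
  case: m Pm minm => // Pm _; case/negP: Pm.
  rewrite /row_free (_ : krylov v Z 1 = v) ?rank_rV ?v0 //.
  by apply/row_matrixP=> i; rewrite rowK ord1 /= row_id.
have free_m : row_free (krylov v Z m).
  apply: contraT => Nf; case: m m0 minm Nf {Pm} => // m _ minm /minm.
  by rewrite ltnn.
split=> //.
have rowi (k : nat) (i : 'I_k) : row i (krylov v Z k) = iter i (mulmx^~ Z) v.
  by rewrite rowK.
have last_in : (iter m (mulmx^~ Z) v <= krylov v Z m)%MS.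
  apply: contraR Pm => Nin.
  have lt_m : (krylov v Z m < krylov v Z m.+1)%MS.
    rewrite ltmxE; apply/andP; split.
      apply/row_subP=> i; rewrite rowi.
      by rewrite -(rowi m.+1 (widen_ord (leqnSn m) i)) row_sub.
    apply: contra Nin => /(submx_trans _); apply.
    by rewrite -(rowi m.+1 ord_max) row_sub.
  by rewrite /row_free eqn_leq rank_leq_row -{1}(eqP free_m) rank_ltmx.
apply/row_subP=> i; rewrite row_mul rowi.
have [lt_im|le_mi] := ltnP i.+1 m.
  by rewrite -[_ *m _](rowi m (Ordinal lt_im)) row_sub.
suff -> : iter i (mulmx^~ Z) v *m Z = iter m (mulmx^~ Z) v by [].
rewrite -[LHS]/(iter i.+1 (mulmx^~ Z) v).
apply: (congr1 (fun k => iter k (mulmx^~ Z) v)).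
by apply/anti_leq; rewrite ltn_ord.
Qed.

(* On the Krylov space of v the operator rho h is triangular with constant
   diagonal lam h, whereas rho [h, z] is a commutator there and has trace 0. *)
Lemma weight_bracket_eq0 (v : 'rV[F]_d) (lam : L -> F) (H : {vspace L}) z :
    v != 0 -> {in H, forall h, br h z \in H} ->
    {in H, forall h, v *m rho h = lam h *: v} ->
  {in H, forall h, lam (br h z) = 0}.
Proof.
move=> v0 Hz vH h hH.
have [m [m_gt0 freeA AZ]] := krylov_rank (rho z) v0.
set A := krylov v (rho z) m in freeA AZ.
pose w i := iter i (mulmx^~ (rho z)) v.
have actA k : k \in H -> exists2 T : 'M_m, A *m rho k = T *m A
    & forall i, T i i = lam k.
  move=> kH.
  have ex (i : 'I_m) : exists t : 'rV_m,
      row i A *m rho k = t *m A /\ t 0 i = lam k.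
    have [c cE] := krylov_weight Hz vH i kH.
    exists (lam k *: delta_mx 0 i
      + \sum_(j < m | (j < i)%N) c j *: delta_mx 0 j); split.
      rewrite rowK cE mulmxDl -scalemxAl -rowE rowK; congr (_ + _).
      rewrite mulmx_suml.
      rewrite (big_ord_widen_cond _ xpredT (fun j => c j *: w j) (ltnW (ltn_ord i))) /=.
      by apply: eq_bigr => j _; rewrite -scalemxAl -rowE rowK.
    rewrite !mxE !eqxx mulr1 summxE big1 ?addr0 // => j lt_ji.
    rewrite !mxE /= (_ : (i == j) = false) ?mulr0 //.
    by apply/eqP=> ij; rewrite ij ltnn in lt_ji.
  have [T TP] := fin_all_exists ex.
  exists (\matrix_i T i).
    by apply/row_matrixP=> i; rewrite !row_mul rowK; case: (TP i).
  by move=> i; rewrite mxE; case: (TP i).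
have [T1 T1E T1d] := actA h hH.
have [T2 T2E T2d] := actA _ (Hz h hH).
pose C := A *m rho z *m pinvmx A.
have CE : A *m rho z = C *m A by rewrite mulmxKpV.
have /(row_free_inj freeA) T2C : T2 *m A = (T1 *m C - C *m T1) *m A.
  by rewrite -T2E rho_br mulmxBr !mulmxA T1E CE mulmxBl -!mulmxA CE T1E !mulmxA.
have : \tr T2 = 0 by rewrite T2C raddfB /= mxtrace_mulC subrr.
rewrite /mxtrace (eq_bigr (fun=> lam (br h z))) ?sumr_const ?card_ord //.
by move=> /eqP; rewrite mulrn_eq0 -leqn0 leqNgt m_gt0 => /eqP.
Qed.

Lemma mx_eigenvector m (T : 'M[F]_m) : (0 < m)%N ->
  exists2 u : 'rV_m, u != 0 & exists c, u *m T = c *: u.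
Proof.
move=> m0.
have [|u u0] := @common_eigenvector _ _ [:: T] m0.
  by move=> A B; rewrite !inE => /eqP-> /eqP->.
by rewrite /= andbT => /sub_rVP[c uT]; exists u => //; exists c.
Qed.

(** The weight of [v] vanishes on every [br h z], so [rho z] preserves the common eigenspace of [H]
    for this weight; an eigenvector of [rho z] inside it serves. *)
Lemma extend_weight (v : 'rV[F]_d) (H : {vspace L}) z :
    v != 0 -> {in H, forall h, br h z \in H} ->
    {in H, forall h, exists c, v *m rho h = c *: v} ->
  exists2 w : 'rV_d, w != 0 &
    {in (H + <[z]>)%VS, forall x, exists c, w *m rho x = c *: w}.
Proof.
move=> v0 Hz exH.
have /rV0Pn[j vj] := v0.
pose lam x := (v *m rho x) 0 j / v 0 j.
have vH : {in H, forall h, v *m rho h = lam h *: v}.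
  by move=> h /exH[c hc]; rewrite /lam hc mxE mulfK.
have lam0 := weight_bracket_eq0 v0 Hz vH.
pose b := vbasis H.
pose E := (\bigcap_(i < \dim H) eigenspace (rho b`_i) (lam b`_i))%MS.
have inE m (B : 'M_(m, d)) : (B <= E)%MS <-> {in H, forall h, B *m rho h = lam h *: B}.
  split=> [/sub_bigcapmxP BE h hH | BH]; last first.
    by apply/sub_bigcapmxP=> i _; apply/eigenspaceP/BH/vbasis_mem/memt_nth.
  have rhoE k (A : 'M_(k, d)) :
      (forall i : 'I_(\dim H), A *m rho b`_i = lam b`_i *: A) ->
      A *m rho h = (\sum_i coord b i h * lam b`_i) *: A.
    move=> AE; rewrite {1}(coord_vbasis hH) linear_sum mulmx_sumr scaler_suml.
    by apply: eq_bigr => i _; rewrite linearZ -scalemxAr AE scalerA.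
  have bH (i : 'I_(\dim H)) : b`_i \in H by exact/vbasis_mem/memt_nth.
  have Bb (i : 'I_(\dim H)) : B *m rho b`_i = lam b`_i *: B.
    by apply/eigenspaceP; apply: BE.
  have vb (i : 'I_(\dim H)) : v *m rho b`_i = lam b`_i *: v by apply: vH.
  rewrite (rhoE _ _ Bb); congr (_ *: _); apply: (mulIf vj).
  by have := vH h hH; rewrite (rhoE _ _ vb) => /rowP/(_ j); rewrite !mxE.
have vE : (v <= E)%MS by apply/inE.
have stabE : (E *m rho z <= E)%MS.
  apply/inE=> h hH; have EE := (inE _ E).1 (submx_refl _).
  have : E *m rho (br h z) = 0 by rewrite EE ?lam0 ?scale0r // Hz.
  rewrite rho_br mulmxBr !mulmxA => /subr0_eq <-.
  rewrite (EE h hH).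
  by rewrite scalemxAl.
pose B := row_base E.
have BZ : B *m rho z = (B *m rho z *m pinvmx B) *m B.
  rewrite mulmxKpV // eq_row_base (submx_trans _ stabE) // submxMr //.
  by rewrite eq_row_base.
have [|u u0 [c uc]] := mx_eigenvector (B *m rho z *m pinvmx B).
  rewrite lt0n mxrank_eq0; apply: contraNneq v0 => E0.
  by move: vE; rewrite E0 submx0.
exists (u *m B).
  by rewrite mulmx_free_eq0 // row_base_free.
have BE : (B <= E)%MS by rewrite eq_row_base.
move=> x /memv_addP[h hH [_ /vlineP[k ->] ->]].
exists (lam h + k * c); rewrite linearD linearZ /= mulmxDr -scalemxAr scalerDl.
rewrite -mulmxA (inE _ B).1 // -scalemxAr; congr (_ + _).
by rewrite -mulmxA BZ mulmxA uc -scalemxAl scalerA.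
Qed.

(** Induction on the derived length: a weight vector of [bracketv br U U] is extended over a basis
    of [U] one vector at a time. Each intermediate subspace contains [bracketv br U U], hence is
    stable under brackets with [U]. *)
Lemma lie_theorem (U : {vspace L}) : (0 < d)%N ->
    (bracketv br U U <= U)%VS -> solvablev br U ->
  exists2 v : 'rV_d, v != 0 & {in U, forall x, exists c, v *m rho x = c *: v}.
Proof.
move=> d_gt0 UU [s]; elim: s U UU => [|s IHs] U UU Us.
  exists (const_mx 1).
    by apply/eqP => /rowP/(_ (Ordinal d_gt0)) /eqP; rewrite !mxE oner_eq0.
  by rewrite [U]Us => x /[!memv0] /eqP->; exists 0; rewrite linear0 mulmx0 scale0r.
have [||v v0 vU'] := IHs (bracketv br U U).
- by apply/bracketvP => x y /(subvP UU) xU /(subvP UU) yU; apply: memv_bracketv.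
- by rewrite dser_bracketv.
suff ext (l : seq L) : {subset l <= U} ->
    exists2 v : 'rV_d, v != 0 &
      {in (bracketv br U U + <<l>>)%VS, forall x, exists c, v *m rho x = c *: v}.
  have [x /vbasis_mem //|w w0 wU] := ext (vbasis U).
  exists w => // x xU; apply: wU; apply: (subvP (addvSr _ _)).
  by rewrite (span_basis (vbasisP U)).
elim: l => [|z l IHl] lU; first by exists v => // x; rewrite span_nil addv0; apply: vU'.
have [x xl|w w0 wH] := IHl; first by rewrite lU // inE xl orbT.
have zU : z \in U by rewrite lU // inE eqxx.
rewrite span_cons [(<[z]> + _)%VS]addvC addvA; apply: extend_weight w0 _ wH.
move=> h hH; apply: (subvP (addvSl _ _)); apply: memv_bracketv => //.
apply: subvP hH; rewrite subv_add UU.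
by apply/span_subvP => x xl; rewrite lU // inE xl orbT.
Qed.

End LieTheorem.

(** * Spans of brackets and right submodules *)

Section Brackets.
Variables (F : fieldType) (L : vectType F) (br : {bilinear L -> L -> L}).
Implicit Types (U V W : {vspace L}).

Lemma bracketvS U U' V V' : (U <= U')%VS -> (V <= V')%VS ->
  (bracketv br U V <= bracketv br U' V')%VS.
Proof.
move=> sU sV; apply/bracketvP => u v /(subvP sU) uU /(subvP sV) vV.
exact: memv_bracketv.
Qed.

Lemma bracketv_ind U V (P : L -> Prop) :
    (forall a u v, P u -> P v -> P (a *: u + v)) -> P 0 ->
    {in U & V, forall u v, P (br u v)} ->
  {in bracketv br U V, forall w, P w}.
Proof.
move=> Plin P0 Pbr w; rewrite -[bracketv _ _ _]/<<in_tuple _>>%VS => /coord_span->.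
elim/big_rec: _ => // i x _ Px; apply: Plin => //.
have /allpairsP[[u v] /= [uU vV ->]] := mem_nth 0 (ltn_ord i).
by apply: Pbr; apply: vbasis_mem.
Qed.

(** By the Leibniz identity the right multiplications represent [L]; these are the submodules for
    that action. *)
Definition right_stable W := forall w x, w \in W -> br w x \in W.

End Brackets.

(** * Weight vectors in quotients of right submodules *)

Section Weights.
Variables (F : numClosedFieldType) (L : vectType F) (br : {bilinear L -> L -> L}).
Hypothesis br_leibniz : is_leibniz br.
Hypothesis br_solvable : solvablev br fullv.
Implicit Types (U V W : {vspace L}) (s : seq 'Hom(L, F^o)).

(** This is Lie's theorem on [W / W'], modelled on a complement [C] of [W'] in [W] with the
    projection [pi] along [W']. *)
Lemma exists_weight_vector W' W :
    right_stable br W' -> right_stable br W -> (W' <= W)%VS -> ~~ (W <= W')%VS ->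
  exists v, exists alpha : 'Hom(L, F^o),
    [/\ v \in W, v \notin W' & forall x, br v x - alpha x *: v \in W'].
Proof.
move=> stW' stW sW'W nsWW'.
pose C := (W :\: W')%VS; pose pi := daddv_pi C W'; pose b := vbasis C.
have capC : (C :&: W' = 0)%VS by apply: capv_diff.
have sCW : (C <= W)%VS by apply: diffvSl.
have subpi w : w \in W -> w - pi w \in W'.
  move=> wW; have wCW : w \in (C + W')%VS by rewrite addv_diff (addv_idPl sW'W).
  by rewrite -{1}(daddv_pi_add capC wCW) addrAC subrr add0r memv_pi.
have pi0 w : w \in W' -> pi w = 0.
  move=> wW'; have wCW : w \in (C + W')%VS by apply: subvP wW'; apply: addvSr.
  apply: (addIr (daddv_pi W' C w)); rewrite daddv_pi_add // add0r.
  by rewrite daddv_pi_id // capvC.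
pose f x : 'M[F]_(\dim C) := \matrix_(i, j) coord b j (pi (br b`_i x)).
have f_lin : linear f.
  by move=> a x y; apply/matrixP=> i j; rewrite !mxE !linearP.
pose rho : {linear L -> 'M[F]_(\dim C)} :=
  HB.pack f (GRing.isLinear.Build _ _ _ _ f f_lin).
pose s (v : 'rV[F]_(\dim C)) := \sum_i v 0 i *: b`_i.
have sC v : s v \in C.
  by apply: memv_suml => i _; rewrite memvZ //; apply/vbasis_mem/memt_nth.
have s_rho v x : s (v *m rho x) = pi (br (s v) x).
  rewrite /s [RHS](coord_vbasis (memv_pi _ _ _)); apply: eq_bigr => j _.
  congr (_ *: _); rewrite mxE linear_sumlz !linear_sum; apply: eq_bigr => i _.
  by rewrite mxE linearZl_LR !linearZ.
have s_inj v w : s v = s w -> v = w.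
  move=> svw; apply/rowP => j.
  have coordE u : coord b j (s u) = u 0 j.
    by rewrite coord_sum_free //; apply: basis_free (vbasisP C).
  by rewrite -!coordE svw.
have sB v w : s (v - w) = s v - s w.
  by rewrite /s -sumrB; apply: eq_bigr => i _; rewrite !mxE scalerBl.
have pi_br w x : w \in W -> pi (br (pi w) x) = pi (br w x).
  move=> wW; apply/esym/subr0_eq; rewrite -linearB -linearBl /=.
  by apply: pi0; apply: stW'; apply: subpi.
have rho_br x y : rho (br x y) = rho x *m rho y - rho y *m rho x.
  apply/row_matrixP => i; rewrite !rowE; apply: s_inj.
  rewrite mulmxBr sB !mulmxA !s_rho !pi_br ?stW ?(subvP sCW) //.
  by rewrite br_leibniz linearB.
have [||v v0 veig] := lie_theorem rho_br (U := fullv) _ _ br_solvable.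
- rewrite lt0n dimv_eq0; apply: contra nsWW'.
  by rewrite diffv_eq0.
- exact: subvf.
have /rV0Pn[j vj] := v0.
pose g x : F^o := (v *m rho x) 0 j / v 0 j.
have g_lin : linear g.
  move=> a x y; rewrite /g linearP mulmxDr -scalemxAr !mxE mulrDl.
  by rewrite -mulrA.
pose lam : {linear L -> F^o} := HB.pack g (GRing.isLinear.Build _ _ _ _ g g_lin).
exists (s v), (linfun lam); split; first exact: subvP (sC v).
- apply: contra v0 => svW'.
  have : s v \in (C :&: W')%VS by rewrite memv_cap sC.
  rewrite capC memv0 => /eqP sv0; apply/eqP/s_inj; rewrite sv0.
  by rewrite /s big1 // => i _; rewrite mxE scale0r.
move=> x; rewrite lfunE /= /g.
have [c vx] := veig x (memvf _).
rewrite vx mxE mulfK //.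
suff -> : c *: s v = pi (br (s v) x) by rewrite subpi // stW ?(subvP sCW).
rewrite -s_rho vx /s scaler_sumr.
by apply: eq_bigr => i _; rewrite mxE scalerA.
Qed.
End Weights.

(** * Flags of right submodules and eigenvalues of right multiplications *)

Section Flags.
Variables (F : numClosedFieldType) (L : vectType F) (br : {bilinear L -> L -> L}).
Hypothesis br_leibniz : is_leibniz br.
Implicit Types (U V W K : {vspace L}) (s : seq 'Hom(L, F^o)).

(* The one-dimensional sections of the right L-module W / W' carry the weights
   listed in s, starting from W'. *)
Fixpoint flag W' W s : Prop :=
  if s is alpha :: s' then
    exists v, [/\ v \notin W', forall x, br v x - alpha x *: v \in W'
      & flag (W' + <[v]>)%VS W s']
  else W' = W.

(** That some iterate of this operator sends [W] into [W'] expresses that right multiplication by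
    [x] has no eigenvalue other than [c] on [W / W'], without forming the quotient. *)
Definition brshift (x : L) (c : F) (w : L) : L := br w x - c *: w.

Lemma brshift_linear x c : linear (brshift x c).
Proof.
move=> a u v; rewrite /brshift linearPl scalerBr scalerDr !scalerA mulrC.
by rewrite opprD addrACA.
Qed.

Lemma iter_brshift_linear m x c : linear (iter m (brshift x c)).
Proof. by elim: m => // m IHm a u v; rewrite /= IHm brshift_linear. Qed.

Lemma iter_brshift_stable m x c W :
  right_stable br W -> {in W, forall w, iter m (brshift x c) w \in W}.
Proof.
move=> stW w wW; elim: m => //= m IHm.
by rewrite /brshift memvB ?memvZ ?stW.
Qed.

Lemma weight_line_stable W v (alpha : L -> F) : right_stable br W ->
    (forall x, br v x - alpha x *: v \in W) ->
  right_stable br (W + <[v]>)%VS.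
Proof.
move=> stW va w x /memv_addP[u uW [_ /vlineP[k ->] ->]].
rewrite linearDl linearZl_LR /=.
rewrite -[br v x](subrK (alpha x *: v)) scalerDr addrA memv_add //.
  by rewrite memvD ?memvZ ?stW.
by rewrite scalerA memvZ ?memv_line.
Qed.

Lemma weight_line_brshift W v (alpha : L -> F) x : right_stable br W ->
    (forall x, br v x - alpha x *: v \in W) ->
  {in (W + <[v]>)%VS, forall w, brshift x (alpha x) w \in W}.
Proof.
move=> stW va _ /memv_addP[u uW [_ /vlineP[k ->] ->]].
rewrite addrC brshift_linear memvD ?memvZ //; first exact: va.
exact: (@iter_brshift_stable 1).
Qed.

Lemma flag_sub W' W s : flag W' W s -> (W' <= W)%VS.
Proof.
elim: s W' => /= [W' -> // | alpha s IHs W' [v [_ _ /IHs]]].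
by apply: subv_trans; apply: addvSl.
Qed.

Lemma flag_exists W' W : solvablev br fullv ->
    right_stable br W' -> right_stable br W -> (W' <= W)%VS ->
  exists2 s, size s = (\dim W - \dim W')%N & flag W' W s.
Proof.
move=> sol stW' stW; have [m] := ubnP (\dim W - \dim W').
elim: m W' stW' => // m IHm W' stW' lt_m sW'W.
have [sWW'|nsWW'] := boolP (W <= W')%VS.
  have eW : W' = W by apply/eqP; rewrite eqEsubv sW'W.
  by exists [::]; rewrite //= eW subnn.
have [v [alpha [vW nvW' va]]] :=
  exists_weight_vector br_leibniz sol stW' stW sW'W nsWW'.
have sUW : (W' + <[v]> <= W)%VS by rewrite subv_add sW'W -memvE.
have dimU : \dim (W' + <[v]>) = (\dim W').+1.
  rewrite dimv_disjoint_sum ?dim_vline.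
    by case: eqP nvW' => [-> | _ _]; rewrite ?mem0v ?addn1.
  apply/eqP; rewrite -subv0; apply/subvP => w /memv_capP[wW' /vlineP[k kE]].
  move: wW'; rewrite kE; have [->|k0] := eqVneq k 0; first by rewrite scale0r !mem0v.
  by move=> /(memvZ k^-1); rewrite scalerA mulVf // scale1r (negPf nvW').
have leW := dimvS sUW.
have [|s sz fl] := IHm _ (weight_line_stable stW' va) _ sUW.
  by rewrite dimU subnSK // -dimU.
exists (alpha :: s); last by exists v.
by rewrite /= sz dimU subnSK // -dimU.
Qed.

Lemma flag_iter_bracketv K W' W s :
    right_stable br W' -> flag W' W s ->
    {in s, forall alpha : 'Hom(L, F^o), {in K, forall x, alpha x = 0}} ->
  (iter (size s) (bracketv br ^~ K) W <= W')%VS.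
Proof.
elim: s W' => /= [W' _ -> //| alpha s IHs W' stW' [v [_ va fl]] s0].
apply: subv_trans (bracketvS _ (IHs _ _ fl _) (subvv K)) _.
- exact: weight_line_stable va.
- by move=> b bs; apply: s0; rewrite inE bs orbT.
apply/bracketvP => w x wW xK; have := weight_line_brshift x stW' va wW.
by rewrite /brshift s0 ?inE ?eqxx // scale0r subr0.
Qed.

Lemma flag_iter_brshift x c W' W s :
    right_stable br W' -> flag W' W s ->
    {in s, forall alpha : 'Hom(L, F^o), alpha x = c} ->
  {in W, forall w, iter (size s) (brshift x c) w \in W'}.
Proof.
elim: s W' => /= [W' _ -> _ w //| alpha s IHs W' stW' [v [_ va fl]] sc w wW].
rewrite -(sc alpha) ?inE ?eqxx //; apply: (weight_line_brshift x stW' va).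
rewrite sc ?inE ?eqxx //; apply: (IHs _ _ fl) => //.
  exact: weight_line_stable va.
by move=> b bs; apply: sc; rewrite inE bs orbT.
Qed.

(** Modulo [W'] the first vector [v] is an eigenvector, so [m] multiplications by [x] scale it by
    [alpha x ^+ m]; as [v] is not in [W'], this scalar is 0. *)
Lemma flag_weight_nilpotent x m W' W s :
    right_stable br W' -> flag W' W s ->
    {in W, forall w, iter m (brshift x 0) w \in W'} ->
  {in s, forall alpha : 'Hom(L, F^o), alpha x = 0}.
Proof.
elim: s W' => // alpha s IHs W' stW' [v [nv va fl]] nil beta.
have stU := weight_line_stable stW' va.
rewrite inE => /predU1P[-> {beta}|]; last first.
  apply: (IHs _ stU fl) => w wW; apply: subvP (nil w wW); exact: addvSl.
have vW : v \in W by rewrite memvE (subv_trans (addvSr _ _) (flag_sub fl)).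
have powE k : iter k (brshift x 0) v - (alpha x) ^+ k *: v \in W'.
  elim: k => [|k IHk] /=; first by rewrite expr0 scale1r subrr mem0v.
  have := @iter_brshift_stable 1 x 0 W' stW' _ IHk => /=.
  rewrite {1}/brshift scale0r subr0 linearBl linearZl_LR /= => h.
  rewrite /brshift scale0r subr0.
  rewrite -[X in X - _](subrK (alpha x ^+ k *: br v x)) -addrA memvD //.
  by rewrite exprSr -scalerA -scalerBr memvZ ?va.
have : alpha x ^+ m *: v \in W'.
  by rewrite -[X in X \in _](subKr (iter m (brshift x 0) v)) memvB ?nil.
apply: contraTeq => ax0; apply: contra nv => /(memvZ (alpha x ^+ m)^-1).
by rewrite scalerA mulVf ?scale1r // expf_neq0.
Qed.

(** On a one-dimensional section right multiplications by [x] and [y] commute, and by the Leibniz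
    identity [br x y] acts as their commutator. *)
Lemma flag_weight_br x y W' W s :
    right_stable br W' -> flag W' W s ->
  {in s, forall alpha : 'Hom(L, F^o), alpha (br x y) = 0}.
Proof.
elim: s W' => // alpha s IHs W' stW' [v [nv va fl]] beta.
have stU := weight_line_stable stW' va.
rewrite inE => /predU1P[-> {beta}|]; last by apply: (IHs _ stU fl).
have two a b : br (br v a) b - (alpha a * alpha b) *: v \in W'.
  have -> : br (br v a) b - (alpha a * alpha b) *: v =
    br (br v a - alpha a *: v) b + alpha a *: (br v b - alpha b *: v).
    by rewrite linearBl linearZl_LR scalerBr /= addrA subrK scalerA.
  by rewrite memvD ?memvZ ?va ?stW'.
have : alpha (br x y) *: v \in W'.
  rewrite -[X in X \in _](subKr (br v (br x y))) memvB ?va //.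
  rewrite br_leibniz.
  have -> : br (br v x) y - br (br v y) x =
    (br (br v x) y - (alpha x * alpha y) *: v)
      - (br (br v y) x - (alpha y * alpha x) *: v).
    by rewrite [alpha y * _]mulrC opprB addrA subrK.
  by rewrite memvB.
apply: contraTeq => ax0; apply: contra nv => /(memvZ (alpha (br x y))^-1).
by rewrite scalerA mulVf ?scale1r.
Qed.

(** Right multiplication by [x] is a derivation, so eigenvalues add up under the bracket. *)
Lemma brshift_br x a b u v :
  brshift x (a + b) (br u v) = br (brshift x a u) v + br u (brshift x b v).
Proof.
rewrite /brshift linearBl linearBr linearZl_LR linearZr_LR /= scalerDl.
have -> : br (br u v) x = br (br u x) v + br u (br v x).
  by rewrite br_leibniz addrC subrK.
by rewrite opprD addrACA.
Qed.

(** Expand by the product rule: after [p + q] shifts every term has received [p] of them on the left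
    or [q] on the right, and stability of [W] absorbs the surplus. *)
Lemma iter_brshift_br x a b U U' V V' W :
    right_stable br U -> right_stable br V -> right_stable br W ->
    (bracketv br U' V <= W)%VS -> (bracketv br U V' <= W)%VS ->
  forall p q u v, u \in U -> v \in V ->
    iter p (brshift x a) u \in U' -> iter q (brshift x b) v \in V' ->
  iter (p + q) (brshift x (a + b)) (br u v) \in W.
Proof.
move=> stU stV stW sU'V sUV'.
elim=> [|p IHp] q.
  move=> u v uU vV uU' _; apply: iter_brshift_stable => //.
  by apply: (subvP sU'V); apply: memv_bracketv.
elim: q => [|q IHq] u v uU vV uU' vV'.
  apply: iter_brshift_stable => //.
  by apply: (subvP sUV'); apply: memv_bracketv.
rewrite addSn iterSr brshift_br -[br _ _ + _]/(_ + _).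
have iterD m c w w' : iter m (brshift x c) (w + w') =
    iter m (brshift x c) w + iter m (brshift x c) w'.
  by rewrite -[w in LHS]scale1r iter_brshift_linear scale1r.
rewrite iterD memvD //.
  by apply: IHp; rewrite -?iterSr // /brshift memvB ?memvZ ?stU.
by rewrite addnS -addSn; apply: IHq; rewrite -?iterSr // /brshift memvB ?memvZ ?stV.
Qed.

Lemma bracketv_right_stable U V :
  right_stable br U -> right_stable br V -> right_stable br (bracketv br U V).
Proof.
move=> stU stV w x; apply: (@bracketv_ind _ _ br U V (fun w => br w x \in _)).
- by move=> a u v uW vW; rewrite linearPl memvD ?memvZ.
- by rewrite linear0l mem0v.
move=> u v uU vV.
have -> : br (br u v) x = br (br u x) v + br u (br v x).
  by rewrite br_leibniz addrC subrK.
by rewrite memvD ?memv_bracketv ?stU ?stV.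
Qed.

Lemma lcs_right_stable N k : right_stable br N -> right_stable br (lcs br N k).
Proof. by move=> stN; elim: k => //= k IHk; apply: bracketv_right_stable. Qed.

(** With indices from 0 this says $[N^{k+1}, N^2] \subseteq N^{k+3}$; the Leibniz identity replaces
    the right factor by two successive brackets with [N]. *)
Lemma lcs_bracketv1 N k :
  (bracketv br (lcs br N k) (bracketv br N N) <= lcs br N k.+2)%VS.
Proof.
apply/bracketvP => u w uk; apply: (@bracketv_ind _ _ br N N (fun w => br u w \in _)).
- by move=> a v v' vW v'W; rewrite linearPr memvD ?memvZ.
- by rewrite linear0r mem0v.
by move=> v v' vN v'N; rewrite br_leibniz memvB // !memv_bracketv.
Qed.

(** [lcs br N k] is $N^{k+1}$, whence the multiple [k.+1]: each further bracket with [N] adds one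
    eigenvalue [c] of $N/N^2$. *)
Lemma lcs_iter_brshift x c N m : right_stable br N ->
    {in N, forall w, iter m (brshift x c) w \in lcs br N 1} ->
  forall k, exists p,
    {in lcs br N k, forall w, iter p (brshift x (c *+ k.+1)) w \in lcs br N k.+1}.
Proof.
move=> stN Nm; elim=> [|k [p IHp]]; first by exists m.
exists (p + m)%N.
apply: bracketv_ind => [a u v uW vW||u v uk vN].
- by rewrite iter_brshift_linear memvD ?memvZ.
- by apply: iter_brshift_stable; rewrite ?mem0v //; apply: (@lcs_right_stable N k.+2).
rewrite [c *+ k.+2]mulrSr.
apply: (@iter_brshift_br x _ c (lcs br N k) (lcs br N k.+1) N (lcs br N 1)) => //.
- exact: lcs_right_stable.
- exact: (@lcs_right_stable N k.+2).
- exact: lcs_bracketv1.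
- exact: IHp.
exact: Nm.
Qed.

End Flags.

(** * Ideals, the right annihilator and the nilradical *)

Section Ideals.
Variables (F : fieldType) (L : vectType F) (br : {bilinear L -> L -> L}).
Hypothesis br_leibniz : is_leibniz br.
Implicit Types (U V W I N M Z : {vspace L}).

Lemma ideal_right_stable I : is_ideal br I -> right_stable br I.
Proof. by move=> idI w x /(idI _ x)[]. Qed.

Lemma bracketv_ideal I : is_ideal br I -> is_ideal br (bracketv br I I).
Proof.
move=> idI w x wII; split; move: w wII; apply: bracketv_ind.
- by move=> a u v uW vW; rewrite linearPl memvD ?memvZ.
- by rewrite linear0l mem0v.
- move=> u v uI vI; have [uxI xuI] := idI u x uI; have [vxI xvI] := idI v x vI.
  have -> : br (br u v) x = br (br u x) v + br u (br v x).
    by rewrite br_leibniz addrC subrK.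
  by rewrite memvD ?memv_bracketv.
- by move=> a u v uW vW; rewrite linearPr memvD ?memvZ.
- by rewrite linear0r mem0v.
move=> u v uI vI; have [uxI xuI] := idI u x uI; have [vxI xvI] := idI v x vI.
by rewrite br_leibniz memvB ?memv_bracketv.
Qed.

Lemma dser_ideal I s : is_ideal br I -> is_ideal br (dser br I s).
Proof. by move=> idI; elim: s => //= s; apply: bracketv_ideal. Qed.

Lemma addv_ideal I M : is_ideal br I -> is_ideal br M -> is_ideal br (I + M)%VS.
Proof.
move=> idI idM _ x /memv_addP[u uI [v vM ->]].
have [uxI xuI] := idI u x uI; have [vxM xvM] := idM v x vM.
by rewrite linearDl linearDr !memv_add.
Qed.

Lemma dserS U V s : (U <= V)%VS -> (dser br U s <= dser br V s)%VS.
Proof. by move=> sUV; elim: s => //= s IHs; apply: bracketvS. Qed.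

(** The first bracket takes [M] into [N], and [m] further brackets with [M] exhaust [N]. *)
Lemma nilpotent_extension N M m : (bracketv br M M <= N)%VS ->
  iter m (bracketv br ^~ M) N = 0%VS -> nilpotentv br M.
Proof.
move=> MM Nm0; exists m.+1; apply/eqP; rewrite -subv0 -Nm0.
by elim: {Nm0} m => //= m IHm; apply: bracketvS.
Qed.

Lemma exists_right_annihilator :
  exists Z : {vspace L}, forall z, z \in Z <-> forall x, br x z = 0.
Proof.
pose b := vbasis {: L}.
exists (\bigcap_(i < \dim {: L}) lker (linfun (br b`_i)))%VS => z.
rewrite memvE; split=> [/subv_bigcapP zZ x | z0]; last first.
  by apply/subv_bigcapP => i _; rewrite -memvE memv_ker lfunE /= z0.
rewrite (coord_vbasis (memvf x)) linear_sumlz big1 // => i _.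
have := zZ i isT; rewrite -memvE memv_ker lfunE /= => /eqP bz.
by rewrite linearZl_LR /= bz scaler0.
Qed.

Lemma right_annihilator_ideal Z :
  (forall z, z \in Z <-> forall x, br x z = 0) -> is_ideal br Z.
Proof.
move=> inZ z y /inZ z0; split; last by rewrite z0 mem0v.
by apply/inZ => x; rewrite br_leibniz !z0 linear0l subrr.
Qed.

Lemma br_sqr0 x y : br y (br x x) = 0.
Proof. by rewrite br_leibniz subrr. Qed.

Lemma br_sym0 x y z : br z (br x y + br y x) = 0.
Proof.
have := br_sqr0 (x + y) z.
rewrite linearDl /= 2!linearDr /=.
by rewrite !linearDr /= !br_sqr0 add0r addr0.
Qed.

(** As a right factor [Z] contributes nothing, so [N + Z] brackets into [N] and acts on [N] from the
    right exactly as [N] does; maximality of [N] concludes. *)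
Lemma nilradical_annihilator N Z : is_nilradical br N ->
  (forall z, z \in Z <-> forall x, br x z = 0) -> (Z <= N)%VS.
Proof.
move=> [idN [k Nk] maxN] inZ; have idZ := right_annihilator_ideal inZ.
rewrite -(maxN (N + Z)%VS _ _ (addvSl _ _)) ?addvSr //; first exact: addv_ideal.
apply: (@nilpotent_extension N _ k).
  apply/bracketvP => _ _ /memv_addP[u uN [z zZ ->]] /memv_addP[u' u'N [z' z'Z ->]].
  by rewrite linearDr (inZ z').1 // addr0 (idN u' _ u'N).2.
apply/eqP; rewrite -subv0 -Nk; elim: {Nk} k => //= k IHk.
apply/bracketvP => w _ /(subvP IHk) wk /memv_addP[u uN [z zZ ->]].
by rewrite linearDr (inZ z).1 // addr0 memv_bracketv.
Qed.

(** [M] is [N] plus the last term of the derived series of [K] that is not inside [N]. *)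
Lemma solvable_ideal_extension N K : is_ideal br N -> is_ideal br K ->
    solvablev br fullv -> ~~ (K <= N)%VS -> (N <= K)%VS ->
  exists M, [/\ is_ideal br M, (N <= M)%VS, ~~ (M <= N)%VS, (M <= K)%VS
    & (bracketv br M M <= N)%VS].
Proof.
move=> idN idK [t Lt0] nKN sNK.
have ex : exists s, (dser br K s <= N)%VS.
  exists t; have := dserS t (subvf K); rewrite Lt0 subv0 => /eqP->.
  by rewrite sub0v.
case: (ex_minnP ex) => -[|s] sN mins; first by rewrite sN in nKN.
have idD := dser_ideal (s := s) idK.
exists (N + dser br K s)%VS; split.
- exact: addv_ideal.
- exact: addvSl.
- by rewrite subv_add subvv /=; apply/negP => /mins; rewrite ltnn.
- rewrite subv_add sNK /=; elim: {sN mins idD} s => //= s IHs.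
  by apply/bracketvP => u v /(subvP IHs) uK _; apply: (idK u v uK).1.
apply/bracketvP => _ _ /memv_addP[u uN [k kD ->]] /memv_addP[u' u'N [k' k'D ->]].
rewrite linearDr memvD //; first exact: (idN u' _ u'N).2.
rewrite linearDl memvD //; first exact: (idN u _ uN).1.
by apply: (subvP sN); apply: memv_bracketv.
Qed.

End Ideals.

(** Evaluate all members of [s] at once. If the kernel lies in [N], rank-nullity makes this map
    surjective and the constant vector is attained; otherwise the kernel supplies the second
    alternative. *)
Lemma common_value_or_kernel (F : fieldType) (L : vectType F)
    (s : seq 'Hom(L, F^o)) (N : {vspace L}) c :
    (size s + \dim N <= \dim {: L})%N ->
  (exists x, {in s, forall alpha, (alpha : 'Hom(L, F^o)) x = c}) \/
  (exists2 x, x \notin N & {in s, forall alpha, (alpha : 'Hom(L, F^o)) x = 0}).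
Proof.
move=> dimN; pose f x : 'rV[F]_(size s) := \row_i s`_i x.
have f_lin : linear f by move=> a x y; apply/rowP => i; rewrite !mxE linearP.
pose T := linfun (HB.pack_for {linear L -> 'rV[F]_(size s)} f
  (GRing.isLinear.Build _ _ _ _ f f_lin)).
have TE x i (lt_i : (i < size s)%N) : s`_i x = T x 0 (Ordinal lt_i).
  by rewrite lfunE mxE.
have [kerN|/subvPn[x kx nxN]] := boolP (lker T <= N)%VS; last first.
  right; exists x => // alpha /(nthP 0)[i lt_i <-].
  by rewrite TE; move: kx; rewrite memv_ker => /eqP->; rewrite mxE.
have /memv_imgP[x _ xE] : const_mx c \in limg T.
  suff -> : limg T = fullv by apply: memvf.
  apply/eqP; rewrite eqEdim subvf /= dimvf /dim /= mul1n.
  have := limg_ker_dim T fullv; rewrite capfv => dimT.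
  rewrite -(leq_add2r (\dim N)) (leq_trans dimN) // -dimT addnC leq_add2l.
  exact: dimvS.
left; exists x => alpha /(nthP 0)[i lt_i <-].
by rewrite TE -xE mxE.
Qed.

(** * Weights on the nilradical and the vanishing of squares *)

Section Main.
Variables (F : numClosedFieldType) (L : vectType F) (br : {bilinear L -> L -> L}).
Hypothesis br_leibniz : is_leibniz br.
Hypothesis br_solvable : solvablev br fullv.
Variable N : {vspace L}.
Hypothesis nilradN : is_nilradical br N.
Hypothesis anticommN : {in N &, forall u v, br u v = - br v u}.
Hypothesis centerN :
  {in N, forall z, {in N, forall u, br u z = 0} -> z \in bracketv br N N}.
Hypothesis dimN : (\dim N - \dim (bracketv br N N) + \dim N <= \dim {: L})%N.

Lemma central_nilradical_eq0 e : e \in N -> (forall x, br e x = 0) -> e = 0.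
Proof.
move=> eN e0; have [idN [k Nk] maxN] := nilradN.
have stN := ideal_right_stable idN.
have stN1 := @lcs_right_stable _ _ _ br_leibniz N 1 stN.
have st0 : right_stable br 0%VS by move=> w x /[!memv0] /eqP->; rewrite linear0l.
have sN1 : (bracketv br N N <= N)%VS.
  by apply/bracketvP => u v uN _; apply: stN.
have [s szs flN1] := flag_exists br_leibniz br_solvable stN1 stN sN1.
have [t _ fl0] := flag_exists br_leibniz br_solvable st0 stN (sub0v N).
have graded x c : {in s, forall alpha : 'Hom(L, F^o), alpha x = c} ->
    forall k, exists p,
    {in lcs br N k, forall w, iter p (brshift br x (c *+ k.+1)) w \in lcs br N k.+1}.
  move=> sc; apply: lcs_iter_brshift => //; apply: flag_iter_brshift flN1 sc.
  exact: stN1.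
have [[x x1]|[x nxN x0]] :=
    @common_value_or_kernel _ _ s N 1 (eq_ind_r (fun n => n + _ <= _)%N dimN szs).
  (* Right multiplication by [x] kills [e], so the shifted operator acts on [e] as the nonzero
     scalar [- j.+1]; hence [e] sinks through the whole lower central series. *)
  suff elcs j : e \in lcs br N j by apply/eqP; rewrite -memv0 -Nk.
  elim: j => //= j IHj; have [p gr] := graded x 1 x1 j.
  have powE i : iter i (brshift br x (1 *+ j.+1)) e = (- j.+1%:R) ^+ i *: e.
    elim: i => [|i IHi] /=; first by rewrite scale1r.
    rewrite IHi /brshift linearZl_LR /= e0 scaler0 sub0r scalerA -scaleNr.
    by rewrite exprS mulNr.
  have := gr e IHj; rewrite powE => /(memvZ ((- j.+1%:R) ^+ p)^-1).
  by rewrite scalerA mulVf ?scale1r // expf_neq0 // oppr_eq0 pnatr_eq0.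
(* Zero weights on $N/N^2$ make right multiplication by [y] nilpotent on each layer of the lower
   central series, hence on [N], so the weights in [t] vanish at [y] too. *)
have nil0 y : {in s, forall alpha : 'Hom(L, F^o), alpha y = 0} ->
    {in t, forall beta : 'Hom(L, F^o), beta y = 0}.
  move=> /graded gr.
  have [m nilm] : exists m, {in N, forall w, iter m (brshift br y 0) w \in lcs br N k}.
    elim: {Nk} k => [|j [m IHm]]; first by exists 0%N.
    have [p] := gr j; rewrite mul0rn => grj.
    by exists (p + m)%N => w wN; rewrite iterD; apply/grj/IHm.
  by apply: flag_weight_nilpotent st0 fl0 _ => w wN; rewrite -Nk; apply: nilm.
(* This common kernel of the weights on [N] contains all brackets, hence is an ideal; it also
   contains [N] and the element [x] outside [N]. *)
pose K := (\bigcap_(i < size t) lker t`_i)%VS.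
have inK y : reflect {in t, forall beta : 'Hom(L, F^o), beta y = 0} (y \in K).
  rewrite memvE; apply: (iffP subv_bigcapP) => [yK beta /(nthP 0)[i it <-] | y0 i _].
    by have := yK (Ordinal it) isT; rewrite -memvE memv_ker => /eqP.
  by rewrite -memvE memv_ker y0 // mem_nth.
have LLK y z : br y z \in K.
  by apply/inK => beta /(flag_weight_br br_leibniz y z st0 fl0).
have idK : is_ideal br K by move=> y z _.
have NK : (N <= K)%VS.
  apply/subvP => y yN; apply/inK/nil0.
  apply: (@flag_weight_nilpotent _ _ br y 1 _ _ _ stN1 flN1) => w wN.
  by rewrite /= /brshift scale0r subr0 memv_bracketv.
have nKN : ~~ (K <= N)%VS.
  by apply: contra nxN => /subvP; apply; apply/inK/nil0.
have [M [idM sNM nMN sMK MM]] :=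
  solvable_ideal_extension br_leibniz idN idK br_solvable nKN NK.
case/negP: nMN; rewrite (maxN M) ?subvv //.
apply: (nilpotent_extension MM (m := size t)); apply/eqP; rewrite -subv0.
apply: (flag_iter_bracketv st0 fl0) => beta bt y /(subvP sMK) /inK.
exact.
Qed.

Theorem leibniz_is_lie : is_lie br.
Proof.
have [idN _ _] := nilradN.
have [Z inZ] := exists_right_annihilator br.
have sZN := nilradical_annihilator br_leibniz nilradN inZ.
have br_sym w y : w \in bracketv br N N -> br y w = - br w y.
  move=> wNN; apply/eqP; rewrite -addr_eq0; apply/eqP; move: w wNN.
  apply: bracketv_ind.
  - move=> a u v u0 v0; rewrite linearPr linearPl /=.
    by rewrite addrACA -scalerDr u0 v0 scaler0 addr0.
  - by rewrite linear0r linear0l addr0.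
  move=> a b aN bN.
  (* The sum [br y u + br u y] lies in [Z], hence in [N]; anticommutativity there moves it to the
     right, where it annihilates. *)
  have swap u v : u \in N -> v \in N -> br (br y u) v = - br (br u y) v.
    move=> uN vN; apply/eqP; rewrite -addr_eq0 -linearDl /=.
    have sZ : br y u + br u y \in Z by apply/inZ => z; rewrite br_sym0.
    by rewrite (anticommN (subvP sZN _ sZ) vN) ((inZ _).1 sZ) oppr0.
  have -> : br (br a b) y = br (br a y) b + br a (br b y).
    by rewrite br_leibniz addrC subrK.
  rewrite (br_leibniz y a b) !swap // (anticommN aN (idN b y bN).1) opprK.
  by rewrite addrACA addNr subrr addr0.
have sqr0 x : br x x = 0.
  have xxZ : br x x \in Z by apply/inZ => y; rewrite br_sqr0.
  have xxN := subvP sZN _ xxZ.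
  apply: central_nilradical_eq0 => // y.
  have xxNN : br x x \in bracketv br N N.
    by apply: (centerN xxN) => u _; rewrite br_sqr0.
  (* A square annihilates as a right factor, and lying in $N^2$ it anticommutes with all of [L], so
     it annihilates as a left factor as well. *)
  by apply: oppr_inj; rewrite oppr0 -(br_sym _ _ xxNN) br_sqr0.
have anti x y : br x y = - br y x.
  apply/eqP; rewrite -addr_eq0; have := sqr0 (x + y).
  by rewrite linearDl /= 2!linearDr /= !sqr0 add0r addr0 => ->.
split=> // x y z.
rewrite (br_leibniz x y z) (anti y) (anti z (br x y)) (anti z x) linearNl /= opprK.
by rewrite subrK subrr.
Qed.
End Main.

(** * Centre and abelianization of the strictly upper triangular matrices *)

Section StrictUpper.
Variables (F : fieldType) (n : nat).
Local Notation T := (strict_upper F n).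

Lemma delta_strict_upper (i j : 'I_n) : (i < j)%N -> delta_mx i j \in T.
Proof.
by move=> lt_ij; rewrite memvE; apply: (sumv_sup (i, j)).
Qed.

Lemma strict_upper_eq0 (A : 'M[F]_n) (i j : 'I_n) : A \in T -> (j <= i)%N -> A i j = 0.
Proof.
move=> /memv_sumP[B BT ->] le_ji; rewrite summxE big1 // => -[k l] /= lt_kl.
have /vlineP[c ->] := BT (k, l) lt_kl.
rewrite !mxE /=; case: eqP => [ik|]; case: eqP => [jl|]; rewrite ?mulr0 //.
by move: lt_kl; rewrite -ik -jl ltnNge le_ji.
Qed.

Lemma mx_commutator_delta (i j k : 'I_n) : i != k ->
  mx_commutator (delta_mx i j) (delta_mx j k) = delta_mx i k :> 'M[F]_n.
Proof.
move=> nik; rewrite /mx_commutator mul_delta_mx mul_delta_mx_0 ?subr0 //.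
by rewrite eq_sym.
Qed.

(** For [i > 0], commute with the unit at $(0, i)$ and compare entries $(0, j)$. For [i = 0], so
    [j = 1], use the unit at $(1, 2)$ and entry $(0, 2)$; the index 2 exists because $n \ge 3$. *)
Lemma strict_upper_center_super (A : 'M[F]_n) (i j : 'I_n) : (2 < n)%N ->
    A \in T -> {in T, forall B, mx_commutator B A = 0} ->
  j = i.+1 :> nat -> A i j = 0.
Proof.
move=> n_gt2 AT cA ji.
have comm (k l : 'I_n) : (k < l)%N -> delta_mx k l *m A = A *m delta_mx k l.
  by move=> /delta_strict_upper/cA/subr0_eq.
have dA (k l p : 'I_n) : (delta_mx k l *m A) k p = A l p.
  rewrite mxE (bigD1 l) //= big1 ?addr0; first by rewrite mxE !eqxx mul1r.
  by move=> q /negPf nql; rewrite mxE nql andbF mul0r.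
have Ad (k l p : 'I_n) : (A *m delta_mx k l) p l = A p k.
  rewrite mxE (bigD1 k) //= big1 ?addr0; first by rewrite mxE !eqxx mulr1.
  by move=> q /negPf nql; rewrite mxE nql mulr0.
have [i0|i_gt0] := posnP i; last first.
  have n_gt0 : (0 < n)%N by apply: ltn_trans (ltn_ord i).
  have /matrixP/(_ (Ordinal n_gt0) j) := comm (Ordinal n_gt0) i i_gt0.
  rewrite dA => ->; rewrite mxE big1 // => q _; rewrite mxE.
  by rewrite -[j == i]val_eqE /= ji (gtn_eqF (ltnSn i)) andbF mulr0.
have lt_jn : (j < Ordinal n_gt2)%N by rewrite ji i0.
have /matrixP/(_ i (Ordinal n_gt2)) := comm j (Ordinal n_gt2) lt_jn.
rewrite Ad => <-; rewrite mxE big1 // => q _; rewrite mxE.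
by rewrite -[i == j]val_eqE /= ji (ltn_eqF (ltnSn i)) mul0r.
Qed.

Lemma strict_upper_sum (A : 'M[F]_n) : A \in T ->
  A = \sum_(ij : 'I_n * 'I_n | (ij.1 < ij.2)%N) A ij.1 ij.2 *: delta_mx ij.1 ij.2.
Proof.
move=> AT; rewrite {1}(matrix_sum_delta A) pair_big /=.
rewrite [LHS](bigID (fun ij : 'I_n * 'I_n => (ij.1 < ij.2)%N)) /=.
rewrite [X in _ + X]big1 ?addr0 // => -[i j] /=.
by rewrite -leqNgt => le_ji; rewrite strict_upper_eq0 // scale0r.
Qed.

Lemma strict_upperP (A : 'M[F]_n) :
  (forall i j : 'I_n, (j <= i)%N -> A i j = 0) -> A \in T.
Proof.
move=> A0; rewrite (matrix_sum_delta A); apply: memv_suml => i _.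
apply: memv_suml => j _; have [le_ji|lt_ij] := leqP j i.
  by rewrite A0 // scale0r mem0v.
by rewrite memvZ // delta_strict_upper.
Qed.

Lemma mx_commutator_strict_upper :
  {in T &, forall A B, mx_commutator A B \in T}.
Proof.
have mulT A B : A \in T -> B \in T -> A *m B \in T.
  move=> AT BT; apply: strict_upperP => i j le_ji; rewrite mxE big1 // => k _.
  have [le_ki|lt_ik] := leqP k i; first by rewrite strict_upper_eq0 ?mul0r.
  by rewrite [B k j]strict_upper_eq0 ?mulr0 // (leq_trans le_ji) // ltnW.
by move=> A B AT BT; rewrite memvB ?mulT.
Qed.

Section Image.
Variables (L : vectType F) (br : {bilinear L -> L -> L}) (f : 'Hom('M[F]_n, L)).
Variable N : {vspace L}.
Hypothesis fT : (f @: T)%VS = N.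
Hypothesis f_inj : {in T &, injective f}.
Hypothesis f_br : {in T &, {morph f : A B / mx_commutator A B >-> br A B}}.

Lemma strict_upper_anticommutative : {in N &, forall u v, br u v = - br v u}.
Proof.
move=> u v; rewrite -fT => /memv_imgP[A AT ->] /memv_imgP[B BT ->].
by rewrite -!f_br // -linearN /mx_commutator opprB.
Qed.

(** $N_{ij} = [N_{i,i+1}, N_{i+1,j}]$. *)
Lemma delta_mem_bracketv (i j : 'I_n) : (i.+1 < j)%N ->
  f (delta_mx i j) \in bracketv br N N.
Proof.
move=> lt_ij; have lt_in : (i.+1 < n)%N by apply: ltn_trans (ltn_ord j).
rewrite -(@mx_commutator_delta i (Ordinal lt_in)); last first.
  by rewrite -val_eqE ltn_eqF // ltnW.
by rewrite f_br ?memv_bracketv -?fT ?memv_img ?delta_strict_upper.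
Qed.

Lemma strict_upper_center : (2 < n)%N ->
  {in N, forall z, {in N, forall u, br u z = 0} -> z \in bracketv br N N}.
Proof.
move=> n_gt2 z; rewrite -{1}fT => /memv_imgP[A AT ->] cA.
have A_comm : {in T, forall B, mx_commutator B A = 0}.
  move=> B BT; apply: f_inj; rewrite ?mem0v ?mx_commutator_strict_upper //.
  by rewrite linear0 f_br // cA // -fT memv_img.
rewrite (strict_upper_sum AT) linear_sum memv_suml // => -[i j] /= lt_ij.
rewrite linearZ /=; move: lt_ij; rewrite leq_eqVlt => /predU1P[ij|lt_ij].
  by rewrite (strict_upper_center_super n_gt2 AT A_comm) // scale0r mem0v.
by rewrite memvZ // delta_mem_bracketv.
Qed.

(** Modulo $N^2$ the images of the [n - 1] units just above the diagonal span [N]. *)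
Lemma dim_strict_upper_abelianization :
  (\dim N - \dim (bracketv br N N) <= n - 1)%N.
Proof.
have lt_S (i : 'I_(n - 1)) : (i.+1 < n)%N by rewrite -[i.+1]add1n -ltn_subRL.
pose X := [seq f (delta_mx (Ordinal (ltnW (lt_S i))) (Ordinal (lt_S i)))
          | i : 'I_(n - 1)].
rewrite leq_subLR; apply: leq_trans (_ : \dim (bracketv br N N + <<X>>) <= _)%N.
  apply: dimvS; apply/subvP => z; rewrite -{1}fT => /memv_imgP[A AT ->].
  rewrite (strict_upper_sum AT) linear_sum memv_suml // => -[i j] /= lt_ij.
  rewrite linearZ memvZ //=; move: lt_ij; rewrite leq_eqVlt => /predU1P[ij|lt_ij].
    have lt_i : (i < n - 1)%N by rewrite ltn_subRL add1n ij.
    apply: (subvP (addvSr _ _)); apply: memv_span; apply/imageP.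
    by exists (Ordinal lt_i) => //; congr (f (delta_mx _ _)); apply: val_inj.
  by apply: (subvP (addvSl _ _)); apply: delta_mem_bracketv.
apply: leq_trans (dimv_add_leqif _ _) _; rewrite leq_add2l.
by rewrite (leq_trans (dim_span _)) // size_image card_ord.
Qed.
End Image.
End StrictUpper.

Theorem theorem3p4 (R : realType) (n : nat) (hn : (3 <= n)%N)
    (L : vectType R[i]) (br : {bilinear L -> L -> L})
    (hL : in_Lnf n (n - 1)%N br) : is_lie br.
Proof.
case: hL => br_leibniz _ br_solvable [N [Q]].
case=> nilradN [f [fT f_inj f_br]] NQ capNQ dimQ.
apply: (leibniz_is_lie br_leibniz br_solvable nilradN).
- exact: strict_upper_anticommutative fT f_br.
- exact: strict_upper_center fT f_inj f_br hn.
(* As [Q] is a complement of dimension [n - 1], the required inequality becomes the bound on $\dim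
   N/N^2$. *)
rewrite -NQ (dimv_disjoint_sum capNQ) dimQ addnC leq_add2l.
exact: dim_strict_upper_abelianization fT f_br.
Qed.
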